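(* Let $A\in\mathbb{R}^{n\times n}$, $B\in\mathbb{R}^{n\times m}$, $C\in\mathbb{R}^{l\times n}$ and let $K\in\mathbb{R}^{m\times l}$ be such that $A-BKC$ is Hurwitz. For given scalars $h>0$, $\varepsilon\ge 0$, $\delta\ge 0$ let there exist real $n\times n$ matrices $P>0$, $U>0$, $X$, $X_1$, $P_2$, $P_3$, $Y_1$, $Y_2$, $Y_3$ and a real $l\times l$ matrix $\Omega\ge 0$ such that $$\Xi>0,\quad \Psi_0\le 0,\quad \Psi_1\le 0,\quad \Phi\le 0,$$ where ($*$ denotes the blocks determined by symmetry) $$\Xi=\begin{bmatrix} P+h\frac{X+X^T}{2} & hX_1-hX\\ * & -hX_1-hX_1^T+h\frac{X+X^T}{2}\end{bmatrix},$$ $$\Phi=\begin{bmatrix}\Phi_{11}&\Phi_{12}&-P_2^TBK\\ *&-P_3^T-P_3&-P_3^TBK\\ *&*&-\Omega\end{bmatrix},$$ $$\Psi_0=\begin{bmatrix}\Psi_{11}-X_\delta & \Psi_{12}+h\frac{X+X^T}{2} & \Psi_{13}+X_{1\delta}\\ * & \Psi_{22}+hU & \Psi_{23}-h(X-X_1)\\ * & * & \Psi_{33}-X_{2\delta}|_{\tau=0}\end{bmatrix},$$ $$\Psi_1=\begin{bmatrix}\Psi_{11}-\frac{X+X^T}{2} & \Psi_{12} & \Psi_{13}+X-X_1 & hY_1^T\\ * & \Psi_{22} & \Psi_{23} & hY_2^T\\ * & * & \Psi_{33}-X_{2\delta}|_{\tau=h} & hY_3^T\\ * & * & * & -hUe^{-2\delta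 h}\end{bmatrix},$$ with $$\Phi_{11}=P_2^T(A-BKC)+(A-BKC)^TP_2+\varepsilon C^T\Omega C+2\delta P,\qquad \Phi_{12}=P+(A-BKC)^TP_3-P_2^T,$$ $$\Psi_{11}=A^TP_2+P_2^TA+2\delta P-Y_1-Y_1^T,\qquad \Psi_{12}=P-P_2^T+A^TP_3-Y_2,$$ $$\Psi_{13}=Y_1^T-P_2^TBKC-Y_3,\qquad \Psi_{22}=-P_3-P_3^T,$$ $$\Psi_{23}=Y_2^T-P_3^TBKC,\qquad \Psi_{33}=Y_3+Y_3^T,$$ $$X_\delta=\left(\tfrac12-\delta h\right)(X+X^T),\qquad X_{1\delta}=(1-2\delta h)(X-X_1),$$ $$X_{2\delta}=\left(\tfrac12-\delta(h-\tau)\right)(X+X^T-2X_1-2X_1^T).$$ Then the closed-loop system $$\dot x(t)=Ax(t)-BKCx(s_k),\quad t\in[s_k,s_{k+1}),\ k=0,1,2,\dots,$$ with $y(t)=Cx(t)$, $s_0=0$ and sampling instants generated by the event-trigger $$s_{k+1}=\min\{s\ge s_k+h\mid (y(s)-y(s_k))^T\Omega(y(s)-y(s_k))\ge\varepsilon\, y^T(s)\Omega y(s)\},$$ is exponentially stable with decay rate $\delta$.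
   Context: For symmetric matrices, $M>0$, $M\ge0$, $M\le 0$ mean positive definite, positive semidefinite, negative semidefinite; matrices written $P>0$, $U>0$, $\Omega\ge 0$ are symmetric. $x(t)\in\mathbb{R}^n$ is the state, which is continuous. The open-loop system is $\dot x=Ax+Bu$, $y=Cx$, and the control is $u(t)=-Ky(s_k)$ for $t\in[s_k,s_{k+1})$. Standing assumption: the sampling instants form an infinite sequence $0=s_0<s_1<s_2<\dots$ with $\lim_{k\to\infty}s_k=\infty$. Exponential stability with decay rate $\delta$ means: there is a constant $M>0$ such that every solution satisfies $|x(t)|\le Me^{-\delta t}|x(0)|$ for all $t\ge0$. The notation $X_{2\delta}|_{\tau=0}$, $X_{2\delta}|_{\tau=h}$ means the expression for $X_{2\delta}$ evaluated at the indicated value of the scalar $\tau$. *)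

(* Defs.v *)
From HB Require Import structures.
From mathcomp Require Import all_boot all_order all_algebra.
From mathcomp Require Import all_classical all_reals all_analysis.
From mathcomp Require Import complex.

Set Implicit Arguments.
Unset Strict Implicit.
Unset Printing Implicit Defensive.

Import Order.TTheory GRing.Theory Num.Theory.
Import numFieldNormedType.Exports.

Local Open Scope classical_set_scope.
Local Open Scope ring_scope.

Section MatrixNotions.
Variable R : realType.

Definition qform n (M : 'M[R]_n) (v : 'cV[R]_n) : R := (v^T *m M *m v) 0 0.

(* The Euclidean norm; the library norm on matrices is the maximum norm. *)
Definition enorm n (v : 'cV[R]_n) : R := Num.sqrt (\sum_i v i 0 ^+ 2).

Definition posdef n (M : 'M[R]_n) : Prop :=
  M^T = M /\ forall v : 'cV[R]_n, v != 0 -> 0 < qform M v.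

Definition possemidef n (M : 'M[R]_n) : Prop :=
  M^T = M /\ forall v : 'cV[R]_n, 0 <= qform M v.

Definition negsemidef n (M : 'M[R]_n) : Prop :=
  M^T = M /\ forall v : 'cV[R]_n, qform M v <= 0.

Definition hurwitz n (M : 'M[R]_n) : Prop :=
  forall z : R[i], eigenvalue (map_mx (real_complex R) M) z ->
    complex.Re z < 0.

(* Symmetric block matrices given by their upper triangular blocks, listed
   row by row. *)
Definition sym2_mx p q (M11 : 'M[R]_p) (M12 : 'M[R]_(p, q)) (M22 : 'M[R]_q)
    : 'M[R]_(p + q) :=
  block_mx M11 M12 M12^T M22.

Definition sym3_mx p q r
    (M11 : 'M[R]_p) (M12 : 'M[R]_(p, q)) (M13 : 'M[R]_(p, r))
    (M22 : 'M[R]_q) (M23 : 'M[R]_(q, r))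
    (M33 : 'M[R]_r) : 'M[R]_(p + (q + r)) :=
  sym2_mx M11 (row_mx M12 M13) (sym2_mx M22 M23 M33).

Definition sym4_mx p q r s
    (M11 : 'M[R]_p) (M12 : 'M[R]_(p, q)) (M13 : 'M[R]_(p, r))
    (M14 : 'M[R]_(p, s))
    (M22 : 'M[R]_q) (M23 : 'M[R]_(q, r)) (M24 : 'M[R]_(q, s))
    (M33 : 'M[R]_r) (M34 : 'M[R]_(r, s))
    (M44 : 'M[R]_s) : 'M[R]_(p + (q + (r + s))) :=
  sym2_mx M11 (row_mx M12 (row_mx M13 M14)) (sym3_mx M22 M23 M24 M33 M34 M44).

End MatrixNotions.

Section LMI.
Variables (R : realType) (n m l : nat).
Variables (A : 'M[R]_n) (B : 'M[R]_(n, m)) (C : 'M[R]_(l, n)) (K : 'M[R]_(m, l)).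
Variables (h eps delta : R).
Variables (P U X X1 P2 P3 Y1 Y2 Y3 : 'M[R]_n) (Omega : 'M[R]_l).

Definition Xi : 'M[R]_(n + n) :=
  sym2_mx
    (P + (h / 2) *: (X + X^T)) (h *: X1 - h *: X)
    (- (h *: X1) - h *: X1^T + (h / 2) *: (X + X^T)).

Definition Phi11 : 'M[R]_n :=
  P2^T *m (A - B *m K *m C) + (A - B *m K *m C)^T *m P2
  + eps *: (C^T *m Omega *m C) + (2 * delta) *: P.

Definition Phi12 : 'M[R]_n := P + (A - B *m K *m C)^T *m P3 - P2^T.

Definition Phi : 'M[R]_(n + (n + l)) :=
  sym3_mx
    Phi11 Phi12        (- (P2^T *m B *m K))
          (- P3^T - P3) (- (P3^T *m B *m K))
                       (- Omega).

Definition Psi11 : 'M[R]_n :=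
  A^T *m P2 + P2^T *m A + (2 * delta) *: P - Y1 - Y1^T.

Definition Psi12 : 'M[R]_n := P - P2^T + A^T *m P3 - Y2.

Definition Psi13 : 'M[R]_n := Y1^T - P2^T *m B *m K *m C - Y3.

Definition Psi22 : 'M[R]_n := - P3 - P3^T.

Definition Psi23 : 'M[R]_n := Y2^T - P3^T *m B *m K *m C.

Definition Psi33 : 'M[R]_n := Y3 + Y3^T.

Definition X_delta : 'M[R]_n := (1 / 2 - delta * h) *: (X + X^T).

Definition X1_delta : 'M[R]_n := (1 - 2 * delta * h) *: (X - X1).

Definition X2_delta (tau : R) : 'M[R]_n :=
  (1 / 2 - delta * (h - tau)) *: (X + X^T - 2 *: X1 - 2 *: X1^T).

Definition Psi0 : 'M[R]_(n + (n + n)) :=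
  sym3_mx
    (Psi11 - X_delta) (Psi12 + (h / 2) *: (X + X^T)) (Psi13 + X1_delta)
                      (Psi22 + h *: U)               (Psi23 - h *: (X - X1))
                                                     (Psi33 - X2_delta 0).

Definition Psi1 : 'M[R]_(n + (n + (n + n))) :=
  sym4_mx
    (Psi11 - (1 / 2) *: (X + X^T)) Psi12 (Psi13 + X - X1)     (h *: Y1^T)
                                   Psi22 Psi23                (h *: Y2^T)
                                         (Psi33 - X2_delta h) (h *: Y3^T)
                          (- ((h * expR (- (2 * delta * h))) *: U)).

End LMI.

Section ClosedLoop.
Variables (R : realType) (n m l : nat).
Variables (A : 'M[R]_n) (B : 'M[R]_(n, m)) (C : 'M[R]_(l, n)) (K : 'M[R]_(m, l)).
Variables (h eps : R) (Omega : 'M[R]_l).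

(* Derivative relative to D: one-sided at an endpoint of an interval D. *)
Definition derivative_within (D : set R) (x : R -> 'cV[R]_n) (t : R)
    (v : 'cV[R]_n) : Prop :=
  (fun r => (r - t)^-1 *: (x r - x t)) @ within D t^' --> v.

Definition is_minimum (D : set R) (a : R) : Prop := D a /\ lbound D a.

Definition sampling_instants (s : nat -> R) : Prop :=
  [/\ s 0%N = 0, (forall k, s k < s k.+1) & s @ \oo --> +oo].

Definition trigger_set (y : R -> 'cV[R]_l) (sk : R) : set R :=
  [set t | sk + h <= t /\
           eps * qform Omega (y t) <= qform Omega (y t - y sk)].

(* Only the values of x on the half-line of nonnegative times matter. *)
Definition closed_loop_solution (x : R -> 'cV[R]_n) (s : nat -> R) : Prop :=
  [/\ {within `[0, +oo[, continuous x},
      sampling_instants s,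
      (forall k t, t \in `[s k, s k.+1[ ->
         derivative_within `[s k, s k.+1[ x t
           (A *m x t - B *m K *m C *m x (s k))) &
      (forall k,
         is_minimum (trigger_set (fun t => C *m x t) (s k)) (s k.+1))].

Definition closed_loop_trajectories : set (R -> 'cV[R]_n) :=
  [set x | exists s, closed_loop_solution x s].

End ClosedLoop.

Definition exponentially_stable (R : realType) (n : nat) (delta : R)
    (S : set (R -> 'cV[R]_n)) : Prop :=
  exists2 M : R, 0 < M &
    forall x, S x -> forall t, 0 <= t ->
      enorm (x t) <= M * expR (- (delta * t)) * enorm (x 0).

(* Main.v *)
(* On the waiting interval [s_k, s_k + h] use the functional
     V(t) = x^T P x + (h - tau) (int_{s_k}^t e^{2 delta (s - t)} x'^T U x' ds
            + Q(x(t), x(s_k))),   tau = t - s_k,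
   where Q is the quadratic form that Xi adds to P, divided by h. Jensen's
   inequality, the free matrices P2, P3 (multiplying the system equation) and
   Y1, Y2, Y3 (multiplying x(t) - x(s_k) = tau v, v the mean velocity) bound
   V' + 2 delta V by a convex combination of the forms Psi0 and Psi1. After the
   waiting time, the trigger condition is violated and Phi <= 0 gives the decay
   of V = x^T P x. Since Q(x, x) = 0, V is continuous across both switchings, so
   e^{2 delta t} V(t) is nonincreasing, and P > 0, Xi > 0 bound V below by a
   multiple of |x|^2. *)
Require Import Defs.
From mathcomp Require Import all_boot all_order all_algebra.
From mathcomp Require Import all_classical all_reals all_analysis.
From mathcomp Require Import ring lra.

Set Implicit Arguments.
Unset Strict Implicit.
Unset Printing Implicit Defensive.

Import Order.TTheory GRing.Theory Num.Theory.
Import numFieldNormedType.Exports.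

Local Open Scope classical_set_scope.
Local Open Scope ring_scope.

(** * Inner products and quadratic forms of symmetric block matrices *)

Section Dot.
Variable R : realType.

Definition dot n (u v : 'cV[R]_n) : R := (u^T *m v) 0 0.

Lemma dotE n (u v : 'cV[R]_n) : dot u v = \sum_i u i 0 * v i 0.
Proof. by rewrite /dot mxE; apply: eq_bigr => i _; rewrite mxE. Qed.

Lemma dotC n (u v : 'cV[R]_n) : dot u v = dot v u.
Proof. by rewrite !dotE; apply: eq_bigr => i _; rewrite mulrC. Qed.

Lemma dot0l n (v : 'cV[R]_n) : dot 0 v = 0.
Proof. by rewrite /dot trmx0 mul0mx mxE. Qed.

Lemma dot0r n (v : 'cV[R]_n) : dot v 0 = 0.
Proof. by rewrite dotC dot0l. Qed.

Lemma dotDr n (u v w : 'cV[R]_n) : dot u (v + w) = dot u v + dot u w.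
Proof. by rewrite /dot mulmxDr mxE. Qed.

Lemma dotDl n (u v w : 'cV[R]_n) : dot (u + v) w = dot u w + dot v w.
Proof. by rewrite /dot linearD mulmxDl mxE. Qed.

Lemma dotNr n (u v : 'cV[R]_n) : dot u (- v) = - dot u v.
Proof. by rewrite /dot mulmxN mxE. Qed.

Lemma dotNl n (u v : 'cV[R]_n) : dot (- u) v = - dot u v.
Proof. by rewrite /dot linearN mulNmx mxE. Qed.

Lemma dotZr n a (u v : 'cV[R]_n) : dot u (a *: v) = a * dot u v.
Proof. by rewrite /dot -scalemxAr mxE. Qed.

Lemma dotZl n a (u v : 'cV[R]_n) : dot (a *: u) v = a * dot u v.
Proof. by rewrite /dot linearZ -scalemxAl mxE. Qed.

Lemma dot_trmx m n (M : 'M[R]_(m, n)) u v : dot u (M^T *m v) = dot v (M *m u).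
Proof. by rewrite dotC /dot trmx_mul trmxK -mulmxA. Qed.

Lemma dot_sym n (M : 'M[R]_n) u v : M^T = M -> dot u (M *m v) = dot v (M *m u).
Proof. by move=> sM; rewrite -{1}sM dot_trmx. Qed.

Lemma qformE n (M : 'M[R]_n) v : qform M v = dot v (M *m v).
Proof. by rewrite /qform /dot mulmxA. Qed.

Lemma dot_col_mx m n (u1 v1 : 'cV[R]_m) (u2 v2 : 'cV[R]_n) :
  dot (col_mx u1 u2) (col_mx v1 v2) = dot u1 v1 + dot u2 v2.
Proof. by rewrite /dot tr_col_mx mul_row_col mxE. Qed.

Lemma qform_sym2 p q (M11 : 'M[R]_p) (M12 : 'M[R]_(p, q)) (M22 : 'M[R]_q) u v :
  qform (sym2_mx M11 M12 M22) (col_mx u v) =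
  dot u (M11 *m u) + 2 * dot u (M12 *m v) + qform M22 v.
Proof.
rewrite !qformE /sym2_mx mul_block_col dot_col_mx !dotDr dot_trmx.
ring.
Qed.

Lemma qform_sym3 p q r (M11 : 'M[R]_p) (M12 : 'M[R]_(p, q))
    (M13 : 'M[R]_(p, r)) (M22 : 'M[R]_q) (M23 : 'M[R]_(q, r)) (M33 : 'M[R]_r)
    u v w :
  qform (sym3_mx M11 M12 M13 M22 M23 M33) (col_mx u (col_mx v w)) =
  dot u (M11 *m u) + 2 * dot u (M12 *m v) + 2 * dot u (M13 *m w)
  + dot v (M22 *m v) + 2 * dot v (M23 *m w) + qform M33 w.
Proof.
rewrite /sym3_mx qform_sym2 qform_sym2 mul_row_col dotDr.
ring.
Qed.

Lemma qform_sym4 p q r s (M11 : 'M[R]_p) (M12 : 'M[R]_(p, q))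
    (M13 : 'M[R]_(p, r)) (M14 : 'M[R]_(p, s)) (M22 : 'M[R]_q)
    (M23 : 'M[R]_(q, r)) (M24 : 'M[R]_(q, s)) (M33 : 'M[R]_r)
    (M34 : 'M[R]_(r, s)) (M44 : 'M[R]_s) u v w e :
  qform (sym4_mx M11 M12 M13 M14 M22 M23 M24 M33 M34 M44)
    (col_mx u (col_mx v (col_mx w e))) =
  dot u (M11 *m u) + 2 * dot u (M12 *m v) + 2 * dot u (M13 *m w)
  + 2 * dot u (M14 *m e)
  + dot v (M22 *m v) + 2 * dot v (M23 *m w) + 2 * dot v (M24 *m e)
  + dot w (M33 *m w) + 2 * dot w (M34 *m e) + qform M44 e.
Proof.
rewrite /sym4_mx qform_sym2 qform_sym3 !mul_row_col !dotDr.
ring.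
Qed.

(** Normal form for bilinear expressions: sums, signs and scalars leave [dot], and matrix products
    associate to the right, so that [ring] and [lra] see the remaining [dot] terms as atoms. *)
Definition mulmx_dotE := (@mulmxDl, @mulNmx, @mulmxDr, @mulmxN, =^~ @scalemxAl,
  =^~ @scalemxAr, =^~ @mulmxA, dotDr, dotDl, dotNr, dotNl, dotZr, dotZl).

End Dot.

(** * Pointwise dissipation inequalities from the matrix inequalities *)

Section Dissipation.
Variables (R : realType) (n m l : nat).
Variables (A : 'M[R]_n) (B : 'M[R]_(n, m)) (C : 'M[R]_(l, n)) (K : 'M[R]_(m, l)).
Variables (h eps delta : R).
Variables (P U X X1 P2 P3 Y1 Y2 Y3 : 'M[R]_n) (Omega : 'M[R]_l).

(* V(t) = x^T P x + (h - (t - s_k)) (looped form + integral term): the looped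
   form vanishes at x = xk, so V is continuous at the sampling instants. *)
Definition loop_form (x xk : 'cV[R]_n) : R :=
  dot x (X *m x) + 2 * dot x ((X1 - X) *m xk) + dot xk ((X - 2 *: X1) *m xk).

(* Derivative of the looped form in x along the velocity z. *)
Definition loop_form' (x z xk : 'cV[R]_n) : R :=
  dot z (X *m x) + dot x (X *m z) + 2 * dot z ((X1 - X) *m xk).

(** A quadratic form sees only the symmetric part of its matrix. Through this identity [Xi > 0]
    bounds the functional from below during the waiting time. *)
Lemma qform_Xi x xk : qform (Xi h P X X1) (col_mx x xk) =
  dot x (P *m x) + h * loop_form x xk.
Proof.
rewrite /Xi qform_sym2 qformE /loop_form !mulmx_dotE !dot_trmx.
by field.
Qed.

(** With [e = C (xk - x)], [F = A - B K C] and [y = C x], the form of [Phi] at [(x, z, e)] is the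
    left-hand side plus [2 (P2 x + P3 z)^T (F x - B K e - z)], which vanishes, plus
    [eps y^T Omega y - e^T Omega e], which is nonnegative. *)
Lemma trigger_dissipation x xk z :
  negsemidef (Phi A B C K eps delta P P2 P3 Omega) ->
  z = A *m x - B *m K *m C *m xk ->
  qform Omega (C *m x - C *m xk) <= eps * qform Omega (C *m x) ->
  2 * delta * dot x (P *m x) + 2 * dot x (P *m z) <= 0.
Proof.
set e := C *m xk - C *m x.
move=> [_ /(_ (col_mx x (col_mx z e)))] Phi_le ztE.
have -> : C *m x - C *m xk = - e by rewrite opprB.
have zE : z = (A - B *m K *m C) *m x - B *m K *m e.
  rewrite ztE /e !(mulmxBl, mulmxBr, mulmxA).
  by rewrite opprB addrA subrK.
move: Phi_le; rewrite qform_sym3 !qformE /Phi11 /Phi12.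
set F := A - B *m K *m C in zE *.
clearbody e F.
have z0 w : dot w z = dot w (F *m x) - dot w (B *m (K *m e)).
  by rewrite zE !mulmx_dotE.
rewrite !mulmx_dotE !dot_trmx.
have := z0 (P2 *m x); have := z0 (P3 *m z).
rewrite ![dot _ (F *m x)]dotC ![dot _ (B *m (K *m e))]dotC ![dot _ z]dotC
  ![dot (Omega *m _) _]dotC.
move=> E1 E2 Phi_le trg.
lra.
Qed.

(* The form is affine in T once v is treated as an independent vector, hence it
   is the convex combination of Psi0 (at T = 0) and Psi1 (at T = h). *)
Lemma sampling_dissipation x xk z v T :
  P^T = P -> U^T = U -> 0 <= T <= h ->
  negsemidef (Psi0 A B C K h delta P U X X1 P2 P3 Y1 Y2 Y3) ->
  negsemidef (Psi1 A B C K h delta P U X X1 P2 P3 Y1 Y2 Y3) ->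
  z = A *m x - B *m K *m C *m xk ->
  x - xk = T *: v ->
  h * (2 * delta * dot x (P *m x) + 2 * dot x (P *m z)
       + (h - T) * dot z (U *m z) - T * expR (- (2 * delta * h)) * dot v (U *m v)
       + (2 * delta * (h - T) - 1) * loop_form x xk
       + (h - T) * loop_form' x z xk) <= 0.
Proof.
move=> symP symU /andP[T_ge0 T_le].
move=> [_ /(_ (col_mx x (col_mx z xk)))] Psi0_le.
move=> [_ /(_ (col_mx x (col_mx z (col_mx xk v))))] Psi1_le zE vE.
(* The weights [h - T] and [T] of the two forms add up to [h], the factor in the conclusion. *)
have {Psi0_le} := mulr_ge0_le0 (_ : 0 <= h - T) Psi0_le.
rewrite subr_ge0 => /(_ T_le) Psi0_le.
have {Psi1_le Psi0_le} := lerD Psi0_le (mulr_ge0_le0 T_ge0 Psi1_le).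
rewrite addr0; apply: le_trans.
rewrite le_eqVlt; apply/orP; left; apply/eqP.
rewrite qform_sym3 qform_sym4 !qformE.
rewrite /Psi11 /Psi12 /Psi13 /Psi22 /Psi23 /Psi33 /X_delta /X1_delta /X2_delta.
rewrite /loop_form /loop_form' !mulmx_dotE !dot_trmx.
have z0 w : dot w (A *m x) = dot w z + dot w (B *m (K *m (C *m xk))).
  by rewrite zE !mulmx_dotE subrK.
(* Applied only to the [Y1], [Y2], [Y3] terms; elsewhere [x], [xk] and [v] are kept as independent
   vectors. *)
have v0 w : dot x w = dot xk w + T * dot v w.
  by rewrite -dotZl -vE !mulmx_dotE addrC subrK.
rewrite [dot (A *m x) _]dotC !z0 ![dot _ (B *m _)]dotC ![dot (_ *m _) z]dotC.
rewrite (v0 (Y1 *m x)) (v0 (Y2 *m z)) (v0 (Y3 *m xk)).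
by field.
Qed.
End Dissipation.

(** * Upper and lower estimates for quadratic forms *)

Section Posdef.
Variable R : realType.

Lemma dotvv_ge0 n (v : 'cV[R]_n) : 0 <= dot v v.
Proof. by rewrite dotE sumr_ge0// => i _; rewrite -expr2 sqr_ge0. Qed.

Lemma enormE n (v : 'cV[R]_n) : enorm v = Num.sqrt (dot v v).
Proof. by rewrite /enorm dotE; under eq_bigr do rewrite expr2. Qed.

Lemma posdef_ge0 n (M : 'M[R]_n) v : posdef M -> 0 <= dot v (M *m v).
Proof.
move=> [_ Mpos]; have [->|/Mpos] := eqVneq v 0; last by rewrite qformE => /ltW.
by rewrite mulmx0 dotvv_ge0.
Qed.

(** For [v != 0] the form of [M] is nonnegative at [c u - (u^T M v) v] with [c = v^T M v > 0], where
    it equals [c] times the difference of the two sides. *)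
Lemma posdef_cauchy_schwarz n (M : 'M[R]_n) u v : posdef M ->
  dot u (M *m v) ^+ 2 <= dot u (M *m u) * dot v (M *m v).
Proof.
move=> MP; have [symM Mpos] := MP.
have [->|/Mpos] := eqVneq v 0.
  by rewrite mulmx0 /dot mulmx0 trmx0 mul0mx mxE expr0n mulr0.
rewrite qformE; set c := dot v _ => c_gt0.
have := posdef_ge0 (c *: u - dot u (M *m v) *: v) MP.
rewrite !mulmx_dotE (dot_sym v u symM) -/c => sq_ge0.
rewrite -subr_ge0 -(pmulr_rge0 _ c_gt0).
by apply: le_trans sq_ge0 _; rewrite le_eqVlt; apply/orP; left; apply/eqP; ring.
Qed.

Lemma posdef_unitmx n (M : 'M[R]_n) : posdef M -> M \in unitmx.
Proof.
move=> [symM Mpos]; rewrite -row_free_unit -kermx_eq0; apply/rowV0P => v.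
move=> /sub_kermxP vM0; apply/eqP/negPn/negP => v0.
have /Mpos : v^T != 0 by apply: contraNN v0 => /eqP v0; rewrite -[v]trmxK v0 trmx0.
by rewrite /qform trmxK vM0 mul0mx mxE ltxx.
Qed.

(* The i-th coordinate of v is the M-inner product of M^-1 e_i with v, so no
   compactness of the sphere is needed. *)
Lemma posdef_coercive n (M : 'M[R]_n) : posdef M ->
  exists2 c, 0 < c & forall v, dot v v <= c * dot v (M *m v).
Proof.
move=> MP; have [symM _] := MP.
pose w i : 'cV[R]_n := invmx M *m delta_mx i 0.
exists (1 + \sum_i dot (w i) (M *m w i)).
  by rewrite ltr_pwDl// sumr_ge0// => i _; exact: posdef_ge0.
move=> v; have Mv_ge0 := posdef_ge0 v MP.
rewrite mulrDl mul1r -[leLHS]add0r lerD// mulr_suml dotE ler_sum// => i _.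
suff -> : v i 0 = dot (w i) (M *m v) by rewrite -expr2 posdef_cauchy_schwarz.
rewrite dot_sym// /w mulmxA mulmxV ?posdef_unitmx// mul1mx dotE.
rewrite (bigD1 i)//= mxE !eqxx mulr1 big1 ?addr0// => j ji.
by rewrite mxE (negPf ji) mulr0.
Qed.

(** Each [|v_i v_j|] is at most [(v_i^2 + v_j^2) / 2], hence at most [dot v v]; the summand 1 keeps
    the constant positive even for [M = 0]. *)
Lemma qform_le n (M : 'M[R]_n) :
  exists2 c, 0 < c & forall v, dot v (M *m v) <= c * dot v v.
Proof.
exists (1 + \sum_i \sum_j `|M i j|).
  by rewrite ltr_pwDl// !sumr_ge0// => i _; rewrite sumr_ge0.
move=> v; have v_ge0 := dotvv_ge0 v.
have sq_le i : v i 0 ^+ 2 <= dot v v.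
  rewrite dotE (bigD1 i)//= expr2 lerDl sumr_ge0// => j _.
  by rewrite -expr2 sqr_ge0.
rewrite mulrDl mul1r -[leLHS]add0r lerD// dotE mulr_suml ler_sum// => i _.
rewrite mxE mulr_sumr mulr_suml ler_sum// => j _.
apply: le_trans (ler_norm _) _; rewrite mulrCA normrM ler_wpM2l//.
rewrite ler_norml; have := sq_le i; have := sq_le j.
have := sqr_ge0 (v i 0 + v j 0); have := sqr_ge0 (v i 0 - v j 0).
move=> *; apply/andP; split; nra.
Qed.

End Posdef.

(** * Calculus of real functions with a prescribed derivative *)

Section Primitive.
Variable R : realType.
Implicit Types (a b : R) (f g df dg : R -> R).

(** The derivative is required only in the interior: the velocity may jump at sampling instants, and
    monotonicity needs just continuity at the end points. *)
Definition primitive_on a b f df :=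
  {within `[a, b], continuous f} /\ forall t, a < t < b -> is_derive t 1 f (df t).

Lemma primitive_cst a b (c : R) : primitive_on a b (fun=> c) (fun=> 0).
Proof.
split; first by apply: continuous_subspaceT => t; exact: cvg_cst.
by move=> t _; exact: is_derive_cst.
Qed.

Lemma primitive_id a b : primitive_on a b id (fun=> 1).
Proof.
split; first by apply: continuous_subspaceT => t; exact: cvg_id.
by move=> t _; exact: is_derive_id.
Qed.

Lemma primitiveD a b f g df dg : primitive_on a b f df ->
  primitive_on a b g dg ->
  primitive_on a b (fun t => f t + g t) (fun t => df t + dg t).
Proof.
move=> [cf Df] [cg Dg]; split; first exact: within_continuousD.
by move=> t tab; apply: is_deriveD; [exact: Df|exact: Dg].
Qed.

Lemma primitiveM a b f g df dg : primitive_on a b f df ->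
  primitive_on a b g dg ->
  primitive_on a b (fun t => f t * g t) (fun t => df t * g t + f t * dg t).
Proof.
move=> [cf Df] [cg Dg]; split.
  by move=> t; apply: cvgM; [exact: cf|exact: cg].
move=> t tab; have := is_deriveM (Df t tab) (Dg t tab).
by move=> /is_derive_eq; apply; rewrite addrC [X in X + _]mulrC.
Qed.

Lemma primitive_expR a b (c : R) :
  primitive_on a b (fun t => expR (c * t)) (fun t => c * expR (c * t)).
Proof.
have D (t : R) : is_derive t (1 : R) (fun t : R => expR (c * t)) (c * expR (c * t)).
  have := is_derive1_comp (is_derive_expR (c * t))
    (@is_deriveZ _ _ _ id c t 1 1 (is_derive_id t 1)).
  by move=> /is_derive_eq; apply; rewrite /GRing.scale/= mulr1 mulrC.
split=> // ; apply: continuous_subspaceT => t.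
by apply/differentiable_continuous/derivable1_diffP.
Qed.

Lemma primitive_sum a b n (f df : 'I_n -> R -> R) :
  (forall i, primitive_on a b (f i) (df i)) ->
  primitive_on a b (fun t => \sum_i f i t) (fun t => \sum_i df i t).
Proof.
move=> fP; elim: n f df fP => [|n IH] f df fP.
  under eq_fun do rewrite big_ord0.
  under [X in primitive_on _ _ _ X]eq_fun do rewrite big_ord0.
  exact: primitive_cst.
under eq_fun do rewrite big_ord_recl.
under [X in primitive_on _ _ _ X]eq_fun do rewrite big_ord_recl.
by apply: primitiveD => //; apply: IH => i; exact: fP.
Qed.

Lemma primitive_ge0 a b f df : a <= b -> primitive_on a b f df ->
  (forall t, a < t < b -> 0 <= df t) -> f a <= f b.
Proof.
move=> ab [cf Df] df_ge0; apply: (@ger0_derive1_ndecr _ f a b) => // t.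
  by rewrite in_itv/= => /Df[].
by rewrite in_itv/= => tab; have [] := Df t tab; rewrite derive1E => _ ->; exact: df_ge0.
Qed.

Lemma primitive_sub a b a' b' f df : a <= a' -> b' <= b ->
  primitive_on a b f df -> primitive_on a' b' f df.
Proof.
move=> aa' bb' [cf Df]; split.
  by apply: continuous_subspaceW cf; apply: subset_itv; rewrite bnd_simp.
by move=> t /andP[at_ tb]; apply: Df; rewrite (le_lt_trans aa')// (lt_le_trans tb).
Qed.

(** The fundamental theorem of calculus for the Lebesgue integral of [f] from [a]. It provides the
    integral term of the functional. *)
Lemma primitive_exists a b f : a < b -> {within `[a, b], continuous f} ->
  exists2 F, F a = 0 & primitive_on a b F f.
Proof.
move=> ab cf.
have fi : (@lebesgue_measure R).-integrable `[a, b] (EFin \o f).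
  exact: continuous_compact_integrable (@segment_compact _ _ _) cf.
pose F x := (\int[@lebesgue_measure R]_(t in `[a, x]) f t)%R.
exists F; first by rewrite /F set_itv1 Rintegral_set1.
split; first exact: (parameterized_integral_continuous (ltW ab) fi).
move=> t /andP[at_ tb].
have ft : {for t, continuous f}.
  by apply: within_continuous_continuous ab cf _; rewrite in_itv/= at_.
have [dF F'] := @continuous_FTC1_closed _ f a t b tb fi at_ ft.
by apply: DeriveDef; [exact: dF|rewrite -derive1E; exact: F'].
Qed.

End Primitive.

(** * Vector-valued primitives and Jensen's inequality *)

Section VectorPrimitive.
Variable R : realType.
Implicit Types a b : R.

Lemma primitive_le0 a b (f df : R -> R) : a <= b -> primitive_on a b f df ->
  (forall t, a < t < b -> df t <= 0) -> f b <= f a.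
Proof.
move=> ab /(primitiveM (primitive_cst a b (-1))) fP df_le0.
have := primitive_ge0 ab fP; rewrite !mulN1r lerN2; apply => t /df_le0.
by rewrite mul0r add0r mulN1r oppr_ge0.
Qed.

Definition vprimitive_on a b n (x z : R -> 'cV[R]_n) :=
  forall i, primitive_on a b (fun t => x t i 0) (fun t => z t i 0).

Lemma vprimitive_cst a b n (v : 'cV[R]_n) :
  vprimitive_on a b (fun=> v) (fun=> 0).
Proof.
move=> i; under [X in primitive_on _ _ _ X]eq_fun do rewrite mxE.
exact: primitive_cst.
Qed.

Lemma vprimitiveD a b n (x z y w : R -> 'cV[R]_n) :
  vprimitive_on a b x z -> vprimitive_on a b y w ->
  vprimitive_on a b (fun t => x t + y t) (fun t => z t + w t).
Proof.
move=> xP yP i; under eq_fun do rewrite mxE.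
under [X in primitive_on _ _ _ X]eq_fun do rewrite mxE.
exact: primitiveD.
Qed.

Lemma vprimitive_mulmx a b m n (M : 'M[R]_(m, n)) x z :
  vprimitive_on a b x z ->
  vprimitive_on a b (fun t => M *m x t) (fun t => M *m z t).
Proof.
move=> xP i; under eq_fun do rewrite mxE.
under [X in primitive_on _ _ _ X]eq_fun do rewrite mxE.
apply: primitive_sum => j; have := primitiveM (primitive_cst a b (M i j)) (xP j).
by under [X in primitive_on _ _ _ X -> _]eq_fun do rewrite mul0r add0r.
Qed.

Lemma vprimitive_dot a b n (x z y w : R -> 'cV[R]_n) :
  vprimitive_on a b x z -> vprimitive_on a b y w ->
  primitive_on a b (fun t => dot (x t) (y t))
    (fun t => dot (z t) (y t) + dot (x t) (w t)).
Proof.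
move=> xP yP; under eq_fun do rewrite dotE.
under [X in primitive_on _ _ _ X]eq_fun do rewrite !dotE -big_split/=.
by apply: primitive_sum => i; exact: primitiveM.
Qed.

Lemma vprimitive_sub a b a' b' n (x z : R -> 'cV[R]_n) : a <= a' -> b' <= b ->
  vprimitive_on a b x z -> vprimitive_on a' b' x z.
Proof. by move=> aa' bb' xP i; exact: primitive_sub (xP i). Qed.

(** At an interior point small increments stay in [[a, b[], so the relative limit gives the ordinary
    one, and taking a coordinate is continuous. *)
Lemma derivative_within_coord a b n (x : R -> 'cV[R]_n) t v i :
  a < t < b -> derivative_within `[a, b[ x t v ->
  is_derive t 1 (fun r => x r i 0) (v i 0).
Proof.
move=> /andP[at_ tb] xv.
have shift_cvg : (h *: 1 + t) @[h --> (0 : R)^'] --> within `[a, b[ t^'.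
  move=> S /nbhs_ballP[e /= e0 eS]; apply/nbhs_ballP.
  exists (Num.min e (Num.min (t - a) (b - t))) => /=.
    by rewrite !lt_min e0 !subr_gt0 at_.
  move=> r /=; rewrite /ball/= sub0r normrN !lt_min => /and3P[re ra rb] r0.
  apply: eS => /=.
  - by rewrite /ball/= /GRing.scale/= mulr1 opprD addrC subrK normrN.
  - by apply: contraNN r0 => /eqP; rewrite /GRing.scale/= mulr1 => rt; apply/eqP; lra.
  - rewrite in_itv/= /GRing.scale/= mulr1.
    by move: ra rb; rewrite !ltr_norml => /andP[? ?] /andP[? ?]; apply/andP; split; lra.
have xv' : h^-1 *: (((fun r => x r i 0) \o shift t) (h *: 1) - x t i 0)
    @[h --> (0 : R)^'] --> v i 0.
  have := cvg_comp _ _ (cvg_comp _ _ shift_cvg xv) (@coord_continuous _ _ _ i 0 v).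
  apply: cvg_trans; apply: near_eq_cvg; apply: nearW => r /=.
  by rewrite !mxE addrK /GRing.scale/= mulr1.
by apply: DeriveDef; [apply/cvg_ex; exists (v i 0)|exact: cvg_lim xv'].
Qed.

Lemma derivative_within_vprimitive a b n (x z : R -> 'cV[R]_n) :
  {within `[a, b], continuous x} ->
  (forall t, a < t < b -> derivative_within `[a, b[ x t (z t)) ->
  vprimitive_on a b x z.
Proof.
move=> cx Dx i; split; last by move=> t tab; exact: derivative_within_coord (Dx t tab).
apply: (@within_continuous_comp _ _ _ _ x (fun v : 'cV[R]_n => v i 0)) cx => v _.
exact: coord_continuous.
Qed.

End VectorPrimitive.

(* Jensen's inequality for the weighted integral J of z^T U z, obtained by
   integrating the tangent inequality z^T U z >= 2 v^T U z - v^T U v. *)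
Lemma jensen_primitive (R : realType) n (U : 'M[R]_n) (d a b : R)
    (x z : R -> 'cV[R]_n) (J : R -> R) v :
  posdef U -> 0 <= d -> a <= b -> vprimitive_on a b x z -> J a = 0 ->
  primitive_on a b J (fun s => expR (d * s) * dot (z s) (U *m z s)) ->
  x b - x a = (b - a) *: v ->
  (b - a) * expR (d * a) * dot v (U *m v) <= J b.
Proof.
move=> Upos d_ge0 ab xP Ja JP vE; have [symU _] := Upos.
set e := expR (d * a).
(* The function [J t - e (2 v^T U x(t) - t v^T U v)] is nondecreasing: the weight is at least its
   value [e] at [a], so the derivative is at least [e (z - v)^T U (z - v)]. *)
have GP := primitiveD JP (primitiveM (primitive_cst a b (- e))
  (primitiveD
    (primitiveM (primitive_cst a b 2)
       (vprimitive_dot (vprimitive_cst a b (U *m v)) xP))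
    (primitiveM (primitive_cst a b (- dot v (U *m v))) (primitive_id a b)))).
have := primitive_ge0 ab GP.
have dotUv w : dot (U *m v) w = dot v (U *m w) by rewrite dotC dot_sym.
have xE : dot v (U *m x b) = dot v (U *m x a) + (b - a) * dot v (U *m v).
  rewrite -[x b](subrK (x a)) vE !mulmx_dotE; ring.
rewrite Ja !dotUv xE => G_ge0.
rewrite -subr_ge0; move: G_ge0; rewrite -subr_ge0 => G_ge0.
apply: le_trans (G_ge0 _) _; last first.
  by rewrite le_eqVlt; apply/orP; left; apply/eqP; ring.
move=> t /andP[at_ tb].
have e_le : e <= expR (d * t) by rewrite ler_expR ler_wpM2l// ltW.
have e_ge0 : 0 <= e := expR_ge0 _.
rewrite !dotUv dot0l.
have z_ge0 := posdef_ge0 (z t) Upos.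
have := posdef_ge0 (z t - v) Upos.
rewrite !mulmx_dotE [dot (z t) (U *m v)]dot_sym// => zv_ge0.
have := mulr_ge0 e_ge0 zv_ge0.
have := ler_wpM2r z_ge0 e_le.
move=> ? ?; lra.
Qed.

(** * Decay over one sampling interval *)

Section Decay.
Variables (R : realType) (n m l : nat).
Variables (A : 'M[R]_n) (B : 'M[R]_(n, m)) (C : 'M[R]_(l, n)) (K : 'M[R]_(m, l)).
Variables (h eps delta : R).
Variables (P U X X1 P2 P3 Y1 Y2 Y3 : 'M[R]_n) (Omega : 'M[R]_l).
Hypothesis symP : P^T = P.
Hypothesis delta_ge0 : 0 <= delta.
Variables (a : R) (x : R -> 'cV[R]_n).

Definition velocity t := A *m x t - B *m K *m C *m x a.

(** The held sample is constant, so the velocity inherits the regularity of [x]. This makes the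
    integrand with [U] continuous, as [primitive_exists] requires. *)
Lemma vprimitive_velocity b : vprimitive_on a b x velocity ->
  vprimitive_on a b velocity (fun t => A *m velocity t + 0).
Proof.
move=> xP; apply: vprimitiveD; first exact: vprimitive_mulmx.
exact: vprimitive_cst.
Qed.

(** [WP] differentiates [expR (2 * delta * t)] times the functional; the product turns the integral
    term into [(h - (t - a)) J t], where the weight inside [J] is free of [t]. At [a] the integral
    and looped terms vanish; at [b] the integral term is nonnegative and is dropped. *)
Lemma waiting_decay (h_gt0 : 0 < h) b : posdef U ->
  negsemidef (Psi0 A B C K h delta P U X X1 P2 P3 Y1 Y2 Y3) ->
  negsemidef (Psi1 A B C K h delta P U X X1 P2 P3 Y1 Y2 Y3) ->
  a < b <= a + h -> vprimitive_on a b x velocity ->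
  expR (2 * delta * b) * (dot (x b) (P *m x b)
    + (h - (b - a)) * loop_form X X1 (x b) (x a))
  <= expR (2 * delta * a) * dot (x a) (P *m x a).
Proof.
move=> Upos Psi0_le Psi1_le /andP[ab bh] xP.
have zP := vprimitive_velocity xP.
have eP := primitive_expR a b (2 * delta).
have zUzP := primitiveM eP (vprimitive_dot zP (vprimitive_mulmx U zP)).
have [J Ja JP] := primitive_exists ab zUzP.1.
have xkP := vprimitive_cst a b (x a).
have loopP := primitiveD (primitiveD (vprimitive_dot xP (vprimitive_mulmx X xP))
  (primitiveM (primitive_cst a b 2)
    (vprimitive_dot xP (vprimitive_mulmx (X1 - X) xkP))))
  (vprimitive_dot xkP (vprimitive_mulmx (X - 2 *: X1) xkP)).
(* The factor [h - (t - a)], in the shape [h + a + (-1) t]. *)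
have timeP := primitiveD (primitive_cst a b (h + a))
  (primitiveM (primitive_cst a b (-1)) (primitive_id a b)).
have WP := primitiveD (primitiveD
  (primitiveM eP (vprimitive_dot xP (vprimitive_mulmx P xP)))
  (primitiveM timeP JP)) (primitiveM (primitiveM eP timeP) loopP).
have dle0 : 0 <= 2 * delta by rewrite mulr_ge0.
have J_ge t : a < t -> t <= b ->
    (t - a) * expR (2 * delta * a)
    * dot ((t - a)^-1 *: (x t - x a)) (U *m ((t - a)^-1 *: (x t - x a))) <= J t.
  move=> at_ tb.
  apply: (jensen_primitive Upos dle0 (ltW at_) (vprimitive_sub (lexx _) tb xP)) => //.
    exact: primitive_sub (lexx _) tb JP.
  by rewrite scalerA divff ?scale1r// subr_eq0 gt_eqF.
have J_ge0 : 0 <= J b.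
  apply: le_trans (J_ge b ab (lexx _)).
  by rewrite !mulr_ge0 ?posdef_ge0 ?expR_ge0// subr_ge0 ltW.
have := primitive_le0 (ltW ab) WP.
rewrite /= Ja -!/(loop_form X X1 _ _).
have -> : loop_form X X1 (x a) (x a) = 0.
  rewrite /loop_form !mulmx_dotE; ring.
rewrite !mulr0 !addr0 => Wdecay.
apply: le_trans (Wdecay _).
  rewrite -subr_ge0; apply: le_trans (_ : 0 <= (h - (b - a)) * J b) _.
    by rewrite mulr_ge0// subr_ge0; lra.
  by rewrite le_eqVlt; apply/orP; left; apply/eqP; ring.
move=> t {Wdecay} /andP[at_ tb].
have {}J_ge := J_ge t at_ (ltW tb).
set v := (t - a)^-1 *: (x t - x a) in J_ge.
have Tt : 0 <= t - a <= h by apply/andP; split; lra.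
have vE : x t - x a = (t - a) *: v.
  by rewrite scalerA divff ?scale1r// subr_eq0 gt_eqF.
have := sampling_dissipation symP Upos.1 Tt Psi0_le Psi1_le (erefl (velocity t)) vE.
rewrite pmulr_rle0// => Dle.
have vU := posdef_ge0 v Upos.
(* Since [t - h <= a], the constant weight in [Psi1] is dominated by the one that Jensen's
   inequality gives on [[a, t]]. *)
have e_le : expR (2 * delta * t) * expR (- (2 * delta * h)) <= expR (2 * delta * a).
  rewrite -expRD ler_expR; nra.
have := ler_wpM2r (mulr_ge0 (andP Tt).1 vU) e_le => JensenE.
have := mulr_ge0_le0 (expR_ge0 (2 * delta * t)) Dle => {}Dle.
rewrite /loop_form /loop_form' in Dle.
rewrite ![dot (velocity t) (P *m _)]dot_sym//.
(* The derivative of the functional is the dissipation form plus this Jensen defect; both are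
   nonpositive. *)
have := lerD Dle (_ : (t - a) * (expR (2 * delta * t)
  * expR (- (2 * delta * h)) * dot v (U *m v)) - J t <= 0).
rewrite addr0 => H; apply: le_trans (H _); last by lra.
rewrite le_eqVlt; apply/orP; left; apply/eqP.
rewrite !mulmx0 !dot0l !dot0r; ring.
Qed.

(** The interval starts at [b], but the held sample is still that of time [a]; as long as the
    trigger is silent, [trigger_dissipation] applies at each instant. *)
Lemma triggering_decay b c :
  negsemidef (Phi A B C K eps delta P P2 P3 Omega) ->
  b <= c -> vprimitive_on b c x velocity ->
  (forall t, b < t < c ->
    qform Omega (C *m x t - C *m x a) <= eps * qform Omega (C *m x t)) ->
  expR (2 * delta * c) * dot (x c) (P *m x c)
  <= expR (2 * delta * b) * dot (x b) (P *m x b).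
Proof.
move=> Phi_le bc xP untriggered.
have VP := primitiveM (primitive_expR b c (2 * delta))
  (vprimitive_dot xP (vprimitive_mulmx P xP)).
apply: (primitive_le0 bc VP) => t tbc.
have := trigger_dissipation Phi_le (erefl (velocity t)) (untriggered t tbc).
move=> /(mulr_ge0_le0 (expR_ge0 (2 * delta * t))); apply: le_trans.
rewrite [dot (velocity t) _]dot_sym//.
by rewrite le_eqVlt; apply/orP; left; apply/eqP; ring.
Qed.

(** The first estimate controls the state on the whole interval. The second compares values of
    [x^T P x] alone, free of the looped term, and serves to pass to the next sampling instant. *)
Lemma sampling_interval_decay b c1 c2 t :
  0 < h -> posdef P -> posdef U -> posdef (Xi h P X X1) -> 0 < c1 -> 0 < c2 ->
  (forall v, dot v v <= c1 * dot v (P *m v)) ->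
  (forall v, dot v v <= c2 * dot v (Xi h P X X1 *m v)) ->
  negsemidef (Psi0 A B C K h delta P U X X1 P2 P3 Y1 Y2 Y3) ->
  negsemidef (Psi1 A B C K h delta P U X X1 P2 P3 Y1 Y2 Y3) ->
  negsemidef (Phi A B C K eps delta P P2 P3 Omega) ->
  vprimitive_on a b x velocity ->
  (forall t, a + h < t < b ->
    qform Omega (C *m x t - C *m x a) <= eps * qform Omega (C *m x t)) ->
  a <= t <= b ->
  expR (2 * delta * t) * dot (x t) (x t)
    <= (c1 + c2) * (expR (2 * delta * a) * dot (x a) (P *m x a)) /\
  (a + h <= t -> expR (2 * delta * t) * dot (x t) (P *m x t)
    <= expR (2 * delta * a) * dot (x a) (P *m x a)).
Proof.
move=> h_gt0 Ppos Upos Xipos c1_gt0 c2_gt0 Pc Xic Psi0_le Psi1_le Phi_le xP untrig.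
move=> /andP[at_ tb].
set Va := expR (2 * delta * a) * dot (x a) (P *m x a).
have Va_ge0 : 0 <= Va by rewrite mulr_ge0 ?expR_ge0 ?posdef_ge0.
have et : 0 <= expR (2 * delta * t) := expR_ge0 _.
have coercive r : expR (2 * delta * r) * dot (x r) (P *m x r) <= Va ->
    expR (2 * delta * r) * dot (x r) (x r) <= (c1 + c2) * Va.
  move=> VrVa; have := ler_wpM2l (expR_ge0 (2 * delta * r)) (Pc (x r)).
  rewrite mulrCA => /le_trans; apply; rewrite [leRHS]mulrDl.
  by rewrite -[leLHS]addr0; apply: lerD;
    [apply: (ler_wpM2l (ltW c1_gt0))|apply: (mulr_ge0 (ltW c2_gt0))].
have [tah|aht] := ltP t (a + h).
  have [->|ta] := eqVneq t a.
    by split; [exact: coercive|].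
  have {}at_ : a < t by rewrite lt_neqAle eq_sym ta.
  have xtP := vprimitive_sub (lexx a) tb xP.
  have atah : a < t <= a + h by rewrite at_ ltW.
  have := waiting_decay h_gt0 Upos Psi0_le Psi1_le atah xtP.
  rewrite -/Va => VtVa; split=> //.
  have := ler_wpM2l (ltW (addr_gt0 c1_gt0 c2_gt0)) VtVa; apply: le_trans.
  rewrite mulrCA; apply: (ler_wpM2l et).
  have := Xic (col_mx (x t) (x a)).
  rewrite dot_col_mx -qformE qform_Xi.
  have := Pc (x t); have := posdef_ge0 (x t) Ppos; have := dotvv_ge0 (x a).
  have := posdef_ge0 (col_mx (x t) (x a)) Xipos; rewrite -qformE qform_Xi.
  set V := dot (x t) (P *m x t); set D := dot (x t) (x t); set L := loop_form _ _ _ _.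
  set Da := dot (x a) (x a) => q_ge0 Da_ge0 V_ge0 V_ge Xi_ge.
  have V_ge' : 0 <= (c1 + c2) * V - D.
    have := mulr_ge0 (ltW c2_gt0) V_ge0; lra.
  have Xi_ge' : 0 <= (c1 + c2) * (V + h * L) - D.
    have := mulr_ge0 (ltW c1_gt0) q_ge0; lra.
  have ta0 : 0 <= t - a by rewrite subr_ge0 ltW.
  have ht0 : 0 <= h - (t - a) by rewrite subr_ge0 lerBlDl ltW.
  (* With [T = t - a], [h (V + (h - T) L) = T V + (h - T) (V + h L)] mixes the forms of [P] and
     [Xi]; the constant [c1 + c2] suits both. *)
  rewrite -(ler_pM2l h_gt0).
  have := mulr_ge0 ta0 V_ge'; have := mulr_ge0 ht0 Xi_ge'.
  lra.
have VtVa : expR (2 * delta * t) * dot (x t) (P *m x t) <= Va; last first.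
  by split=> //; exact: coercive.
have ahb : a + h <= b := le_trans aht tb.
have aah : a < a + h <= a + h by rewrite lexx ltrDl h_gt0.
have := waiting_decay h_gt0 Upos Psi0_le Psi1_le aah (vprimitive_sub (lexx a) ahb xP).
(* At time [a + h] the looped term has weight zero, so the triggering phase starts from
   [x^T P x]. *)
rewrite -/Va addrAC subrr add0r subrr mul0r addr0; apply: le_trans.
have aah' : a <= a + h by rewrite lerDl ltW.
apply: triggering_decay Phi_le aht (vprimitive_sub aah' tb xP) _ => r /andP[hr rt].
by apply: untrig; rewrite hr (lt_le_trans rt).
Qed.
End Decay.

(** * Covering of the time axis and exponential stability *)

Lemma sampling_instants_cover (R : realType) (s : nat -> R) t :
  sampling_instants s -> 0 <= t -> exists k, s k <= t < s k.+1.
Proof.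
move=> [s0 _ /cvgryPgt s_oo] t_ge0.
have [N _ sN] := s_oo t.
have exN : exists k, t < s k by exists N; apply: sN => /=.
(* The least index with [t < s k] is not 0, as [s 0 = 0 <= t]; its predecessor is the one sought. *)
case: (ex_minnP exN) => [[|k]]; first by rewrite s0 ltNge t_ge0.
move=> tk kmin; exists k; rewrite tk andbT leNgt.
by apply/negP => /kmin; rewrite ltnn.
Qed.

Lemma sampling_instants_ge0 (R : realType) (s : nat -> R) k :
  sampling_instants s -> 0 <= s k.
Proof.
move=> [s0 s_incr _]; elim: k => [|k IH]; first by rewrite s0.
exact: le_trans IH (ltW (s_incr k)).
Qed.

Theorem theorem1 (R : realType) (n m l : nat)
    (A : 'M[R]_n) (B : 'M[R]_(n, m)) (C : 'M[R]_(l, n)) (K : 'M[R]_(m, l))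
    (h eps delta : R)
    (P U X X1 P2 P3 Y1 Y2 Y3 : 'M[R]_n) (Omega : 'M[R]_l)
    (hurwitzABKC : hurwitz (A - B *m K *m C))
    (h_gt0 : 0 < h) (eps_ge0 : 0 <= eps) (delta_ge0 : 0 <= delta)
    (P_pos : posdef P) (U_pos : posdef U) (Omega_ge0 : possemidef Omega)
    (Xi_pos : posdef (Xi h P X X1))
    (Psi0_le0 : negsemidef (Psi0 A B C K h delta P U X X1 P2 P3 Y1 Y2 Y3))
    (Psi1_le0 : negsemidef (Psi1 A B C K h delta P U X X1 P2 P3 Y1 Y2 Y3))
    (Phi_le0 : negsemidef (Phi A B C K eps delta P P2 P3 Omega)) :
  exponentially_stable delta
    (closed_loop_trajectories A B C K h eps Omega).
Proof.
have [c1 c1_gt0 Pc] := posdef_coercive P_pos.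
have [c2 c2_gt0 Xic] := posdef_coercive Xi_pos.
have [c3 c3_gt0 Ple] := qform_le P.
(* [c3] bounds the initial [x^T P x] by the squared norm and [c1 + c2] leads back to a squared norm,
   whence the root. *)
exists (Num.sqrt ((c1 + c2) * c3)).
  by rewrite sqrtr_gt0 mulr_gt0 ?addr_gt0.
move=> x [s [cx s_inst Dx trig]] t t_ge0.
have [s0 s_incr _] := s_inst.
have decay k r : s k <= r <= s k.+1 ->
    expR (2 * delta * r) * dot (x r) (x r)
      <= (c1 + c2) * (expR (2 * delta * s k) * dot (x (s k)) (P *m x (s k))) /\
    (s k + h <= r -> expR (2 * delta * r) * dot (x r) (P *m x r)
      <= expR (2 * delta * s k) * dot (x (s k)) (P *m x (s k))).
  move=> skr; apply: (sampling_interval_decay P_pos.1 delta_ge0 h_gt0 P_pos U_pos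
    Xi_pos c1_gt0 c2_gt0 Pc Xic Psi0_le0 Psi1_le0 Phi_le0 _ _ skr).
    apply: derivative_within_vprimitive => [|r' /andP[skr' r'sk]].
      apply: continuous_subspaceW cx => r' /=; rewrite !in_itv/= andbT.
      by move=> /andP[+ _]; apply: le_trans; exact: sampling_instants_ge0.
    by apply: Dx; rewrite in_itv/= ltW.
  (* A triggering time before [s k.+1] and past the waiting time would contradict minimality. *)
  move=> r' /andP[hr' r'sk]; rewrite leNgt; apply/negP => /ltW trig_r'.
  by have := (trig k).2 r' (conj (ltW hr') trig_r'); rewrite leNgt r'sk.
have Vk k : expR (2 * delta * s k) * dot (x (s k)) (P *m x (s k))
    <= dot (x 0) (P *m x 0).
  elim: k => [|k]; first by rewrite s0 mulr0 expR0 mul1r.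
  (* Membership of [s k.+1] in the trigger set puts it past the waiting time. *)
  apply: le_trans; apply: (decay k (s k.+1) _).2; last exact: (trig k).1.1.
  by rewrite lexx ltW.
have [k /andP[skt tsk]] := sampling_instants_cover s_inst t_ge0.
have [|xt_le _] := decay k t; first by rewrite skt ltW.
have xt_le0 : expR (2 * delta * t) * dot (x t) (x t)
    <= (c1 + c2) * c3 * dot (x 0) (x 0).
  apply: le_trans xt_le _; rewrite -[leRHS]mulrA ler_pM2l ?addr_gt0//.
  exact: le_trans (Vk k) (Ple _).
have sq_expR : expR (- (delta * t)) ^+ 2 * expR (2 * delta * t) = 1.
  by rewrite expr2 -!expRD -[RHS]expR0; congr expR; ring.
have cc_ge0 : 0 <= (c1 + c2) * c3 by rewrite ltW// mulr_gt0 ?addr_gt0.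
(* Everything is gathered under one square root, which reduces the claim to the squared estimate. *)
rewrite !enormE -[expR _]ger0_norm ?expR_ge0// -sqrtr_sqr -!sqrtrM ?(mulr_ge0 cc_ge0 (sqr_ge0 _))//.
rewrite ler_wsqrtr// -[leLHS]mul1r -sq_expR -[leLHS]mulrA [leRHS]mulrAC [leRHS]mulrC.
by rewrite ler_wpM2l ?sqr_ge0.
Qed.
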